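(* Let $\boldsymbol{x}\in\{0,1\}^{\mathcal F}$ with $\sum_{f\in\mathcal F}x_f\le N_c$. The follower problem $Q(\boldsymbol{x})$ (defined in the context) can be equivalently written as the following optimization problem in the variables $\boldsymbol{y}=(y_{f,i})$, $\boldsymbol{\lambda}=(\lambda_{f,i})$, $\boldsymbol{v}=(\boldsymbol{v_{f,i}})$ with $y_{f,i},\lambda_{f,i}\in\mathbb{R}$, $\boldsymbol{v_{f,i}}\in\mathbb{R}^{L}$ for $f\in\mathcal F$, $i\in\{1,\dots,N_p\}$: $$\max_{\boldsymbol{y},\boldsymbol{\lambda},\boldsymbol{v}}\ \sum_{f\in\mathcal F}\sum_{i=1}^{N_p}W_f\,y_{f,i}$$ subject to $$\begin{aligned} & y_{f,1}\le 1-x_f, && f\in\mathcal F,\\ & y_{f,i}\le y_{f,i-1}, && f\in\mathcal F,\ i\in\{2,\dots,N_p\},\\ & y_{f,i}\le (\boldsymbol{u^f})^\top\boldsymbol{v_{f,i}}+\lambda_{f,i}, && f\in\mathcal F,\ i\in\{1,\dots,N_p\},\\ & (\boldsymbol{U^f_s})^\top\boldsymbol{v_{f,1}}+\lambda_{f,1}x_s\le 0, && f,s\in\mathcal F,\ (s,f)\in\mathcal A,\\ & (\boldsymbol{U^f_s})^\top\boldsymbol{v_{f,i}}+\lambda_{f,i}(1-y_{s,i-1})\le 0, && f,s\in\mathcal F,\ (s,f)\in\mathcal A,\ i\in\{2,\dots,N_p\},\\ & (\boldsymbol{U^f_s})^\top\boldsymbol{v_{f,i}}\le 0, && f,s\in\mathcal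 F,\ (s,f)\notin\mathcal A,\ i\in\{1,\dots,N_p\},\\ & \boldsymbol{v_{f,i}}\ge 0, && f\in\mathcal F,\ i\in\{1,\dots,N_p\},\\ & 0\le y_{f,i}\le 1, && f\in\mathcal F,\ i\in\{1,\dots,N_p\},\\ & 0\le\lambda_{f,i}\le 1, && f\in\mathcal F,\ i\in\{1,\dots,N_p\}. \end{aligned}$$ Here ''equivalently written'' means: $\boldsymbol{y}$ is feasible for the follower problem if and only if there exist $\boldsymbol{\lambda},\boldsymbol{v}$ such that $(\boldsymbol{y},\boldsymbol{\lambda},\boldsymbol{v})$ is feasible for the problem displayed above (the objectives are the same function of $\boldsymbol{y}$, so the optimal values coincide).
   Context: $\mathcal F$ is a finite set of assets, $N=|\mathcal F|$; $N_c\le N$ and $N_p\ge1$ are integers; $\mathcal A\subset\mathcal F\times\mathcal F$ is a set of directed arcs; $W_f\ge0$ are given weights for $f\in\mathcal F$. For each $f\in\mathcal F$, the polytope of admissible arc weights into $f$ (the same for all stages $i$) is $$\mathcal P_f=\Big\{\boldsymbol{P}=(P_{s})_{s\in\mathcal F}:\ P_{s}\ge0,\ \sum_{s\in\mathcal F}U^f_{l,s}P_{s}\ge u^f_l\ \text{ for all } l\in L\Big\},$$ where $L$ is a finite index set and $U^f_{l,s},u^f_l$ are given real constants. An element of $\mathcal P_f$ used at stage $i$ is written $\boldsymbol{P_{f,i}}=(P_{s,f,i})_{s\in\mathcal F}$. Put $\boldsymbol{u^f}=(u^f_l)_{l\in L}\in\mathbb R^L$ and $\boldsymbol{U^f_s}=(U^f_{l,s})_{l\in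 L}\in\mathbb R^L$. For $\boldsymbol{P_{f,i}}\in\mathcal P_f$ and $\boldsymbol{w}\in[0,1]^{\mathcal F}$ define $$\phi_f(\boldsymbol{P_{f,i}},\boldsymbol{w})=\Big[1-\sum_{s:(s,f)\in\mathcal A}P_{s,f,i}\,w_s\Big]^+,\qquad [t]^+=\max\{t,0\}.$$ The follower problem for given $\boldsymbol{x}$ is $$Q(\boldsymbol{x})=\max_{0\le\boldsymbol{y}\le1}\ \sum_{f\in\mathcal F}\sum_{i=1}^{N_p}W_f\,y_{f,i}$$ subject to: $y_{f,1}\le1-x_f$ for $f\in\mathcal F$; $y_{f,i}\le y_{f,i-1}$ for $f\in\mathcal F$, $i\in\{2,\dots,N_p\}$; $y_{f,1}\le\phi_f(\boldsymbol{P_{f,1}},\boldsymbol{x})$ for $f\in\mathcal F$ and all $\boldsymbol{P_{f,1}}\in\mathcal P_f$; and $y_{f,i}\le\phi_f(\boldsymbol{P_{f,i}},\boldsymbol{1}-\boldsymbol{y_{i-1}})$ for $f\in\mathcal F$, $i\in\{2,\dots,N_p\}$ and all $\boldsymbol{P_{f,i}}\in\mathcal P_f$, where $\boldsymbol{y_{i-1}}=(y_{s,i-1})_{s\in\mathcal F}$ and $\boldsymbol{1}$ is the all-ones vector. *)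

(* Defs.v *)
From mathcomp Require Import all_boot all_order all_algebra.
From mathcomp Require Import classical_sets reals.

Set Implicit Arguments.
Unset Strict Implicit.
Unset Printing Implicit Defensive.

Import Order.TTheory GRing.Theory Num.Theory.
Local Open Scope classical_set_scope.
Local Open Scope ring_scope.

(* The stages 1, ..., Np are the ordinals 0, ..., Np - 1 of 'I_Np: the first
   stage is the i with i = 0 :> nat, and (j, i) are consecutive stages when
   i = j.+1 :> nat. *)

Definition dot (R : realType) (L : finType) (a b : L -> R) : R :=
  \sum_l a l * b l.

(* U f s is the vector (U^f_{l,s})_l and u f the vector (u^f_l)_l. *)
Definition admissible_weights (R : realType) (F L : finType)
    (U : F -> F -> L -> R) (u : F -> L -> R) (f : F) : set (F -> R) :=
  [set P | (forall s, 0 <= P s) /\ forall l, \sum_s U f s l * P s >= u f l].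

Definition phi (R : realType) (F : finType) (A : {set F * F}) (f : F)
    (P w : F -> R) : R :=
  Num.max (1 - \sum_(s | (s, f) \in A) P s * w s) 0.

Definition objective (R : realType) (F : finType) (Np : nat) (W : F -> R)
    (y : F -> 'I_Np -> R) : R :=
  \sum_f \sum_(i < Np) W f * y f i.

Record follower_feasible (R : realType) (F L : finType) (Np : nat)
    (A : {set F * F}) (U : F -> F -> L -> R) (u : F -> L -> R) (x : F -> R)
    (y : F -> 'I_Np -> R) : Prop := FollowerFeasible {
  ff_init : forall f (i : 'I_Np), i = 0%N :> nat -> y f i <= 1 - x f;
  ff_mono : forall f (j i : 'I_Np), i = j.+1 :> nat -> y f i <= y f j;
  ff_robust_init : forall f (i : 'I_Np), i = 0%N :> nat ->
    forall P, admissible_weights U u f P -> y f i <= phi A f P x;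
  ff_robust : forall f (j i : 'I_Np), i = j.+1 :> nat ->
    forall P, admissible_weights U u f P ->
      y f i <= phi A f P (fun s => 1 - y s j);
  ff_box : forall f i, 0 <= y f i <= 1
}.

Record reformulation_feasible (R : realType) (F L : finType) (Np : nat)
    (A : {set F * F}) (U : F -> F -> L -> R) (u : F -> L -> R) (x : F -> R)
    (y lam : F -> 'I_Np -> R) (v : F -> 'I_Np -> L -> R) : Prop :=
  ReformulationFeasible {
  rf_init : forall f (i : 'I_Np), i = 0%N :> nat -> y f i <= 1 - x f;
  rf_mono : forall f (j i : 'I_Np), i = j.+1 :> nat -> y f i <= y f j;
  rf_dual_value : forall f i, y f i <= dot (u f) (v f i) + lam f i;
  rf_dual_init : forall f s (i : 'I_Np), (s, f) \in A -> i = 0%N :> nat ->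
    dot (U f s) (v f i) + lam f i * x s <= 0;
  rf_dual_arc : forall f s (j i : 'I_Np), (s, f) \in A -> i = j.+1 :> nat ->
    dot (U f s) (v f i) + lam f i * (1 - y s j) <= 0;
  rf_dual_nonarc : forall f s i, (s, f) \notin A ->
    dot (U f s) (v f i) <= 0;
  rf_v_ge0 : forall f i l, 0 <= v f i l;
  rf_y_box : forall f i, 0 <= y f i <= 1;
  rf_lam_box : forall f i, 0 <= lam f i <= 1
}.

Definition is_max_value (R : realType) (T : Type) (S : set T) (obj : T -> R)
    (q : R) : Prop :=
  (obj @` S) q /\ ubound (obj @` S) q.

(* Main.v *)
Require Import Defs.
From mathcomp Require Import all_boot all_order all_algebra.
From mathcomp Require Import classical_sets reals.
From mathcomp Require Import boolp lra.

Import Order.TTheory GRing.Theory Num.Theory.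
Local Open Scope classical_set_scope.
Local Open Scope ring_scope.

(** Since [[t]^+ = min {r : r >= 0, r >= t}], the bound
    [y <= phi_f(P, w) for all P in P_f] says that [y] is at most the value of
    the linear program [min r] over [P >= 0], [r >= 0], [U P >= u],
    [r + sum P_s w_s >= 1].  The displayed constraints on [(v, lambda)] are
    feasibility for its dual, with objective at least [y].  Strong duality,
    including the case of an empty [P_f], follows from Farkas' lemma applied to
    the homogenized program; Farkas' lemma is proved by Bartl's induction on
    the number of inequalities. *)

Lemma farkas_seq (R : realFieldType) (I : finType) (J : eqType) (s : seq J)
    (a : J -> I -> R) (b : I -> R) :
  uniq s ->
  (forall z : I -> R, (forall j, j \in s -> 0 <= \sum_i a j i * z i) ->
     0 <= \sum_i b i * z i) ->
  exists2 c : J -> R, forall j, 0 <= c j &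
    forall i, b i = \sum_(j <- s) c j * a j i.
Proof.
elim: s a b => [|k s IHs] a b /=.
  (* With no constraints left, testing [b] at plus and minus each unit vector forces [b = 0]. *)
  move=> _ b_ge0; exists (fun=> 0) => // i; rewrite big_nil.
  have sum_delta : \sum_j b j * (j == i)%:R = b i.
    rewrite (bigD1 i) //= eqxx mulr1 big1 ?addr0 // => j /negPf ->.
    by rewrite mulr0.
  have := b_ge0 (fun j => - (j == i)%:R); under eq_bigr do rewrite mulrN.
  rewrite sumrN sum_delta oppr_ge0 => /(_ (fun _ => ltac:(by []))) bi_le0.
  apply/eqP; rewrite eq_le bi_le0 /= -sum_delta; exact: b_ge0.
case/andP=> ks us b_ge0.
case: (pselect (forall z : I -> R,
    (forall j, j \in s -> 0 <= \sum_i a j i * z i) -> 0 <= \sum_i b i * z i)).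
  (* Constraint [k] is redundant here and gets coefficient 0; uniqueness keeps this override away
     from [s]. *)
  move=> /(IHs a b us)[c c_ge0 bE].
  exists (fun j => if j == k then 0 else c j) => [j|i]; first by case: ifP.
  rewrite big_cons eqxx mul0r add0r bE; apply: eq_big_seq => j js.
  by case: eqP => // jk; rewrite jk (negPf ks) in js.
move=> /existsNP[z0 /not_implyP[az0 /negP]]; rewrite -ltNge => bz0.
have akz0 : \sum_i a k i * z0 i < 0.
  rewrite ltNge; apply/negP => akz0; move: bz0; rewrite ltNge => /negP[].
  by apply: b_ge0 => j; rewrite inE => /orP[/eqP ->|/az0].
set t := \sum_i a k i * z0 i in akz0.
(* Chosen so that [a j - p j * a k] and [b - q * a k] vanish at [z0]; they are [a j] and [b]
   composed with the projection [z - (a k z / t) z0]. *)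
pose p j := (\sum_i a j i * z0 i) / t.
pose q := (\sum_i b i * z0 i) / t.
have sumBl (g h z : I -> R) r :
    \sum_i (g i - r * h i) * z i = \sum_i g i * z i - r * \sum_i h i * z i.
  by rewrite mulr_sumr -sumrB; apply: eq_bigr => i _; rewrite mulrBl mulrA.
have sumBr (g z z' : I -> R) r :
    \sum_i g i * (z i - r * z' i) = \sum_i g i * z i - r * \sum_i g i * z' i.
  by rewrite mulr_sumr -sumrB; apply: eq_bigr => i _; rewrite mulrBr mulrCA.
(* Project along [z0] onto the kernel of [a k]. *)
case: (IHs (fun j i => a j i - p j * a k i) (fun i => b i - q * a k i) us).
  move=> z az; rewrite sumBl.
  set r := (\sum_i a k i * z i) / t.
  have := b_ge0 (fun i => z i - r * z0 i); rewrite sumBr.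
  have shift g : r * g = g / t * \sum_i a k i * z i by rewrite /r; lra.
  rewrite shift; apply => j; rewrite inE sumBr => /orP[/eqP ->|js].
    by rewrite /r -/t divfK ?subrr // lt_eqF.
  by rewrite shift; have := az j js; rewrite sumBl.
move=> c c_ge0 bE.
(* The total coefficient of [a k] once the projected identity is expanded; it is nonnegative since
   [q > 0] and [p j <= 0] on [s]. *)
pose ck := q - \sum_(j <- s) c j * p j.
have p_le0 j : j \in s -> p j <= 0.
  by move=> js; rewrite /p mulr_ge0_le0 ?az0 // invr_le0 ltW.
exists (fun j => if j == k then ck else c j) => [j|i].
  case: ifP => // _; rewrite subr_ge0; apply: (@le_trans _ _ 0).
    by rewrite big_seq sumr_le0 // => j' j's; rewrite mulr_ge0_le0 ?p_le0.
  by rewrite ltW // /q nmulr_lgt0 // invr_lt0.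
rewrite big_cons eqxx.
have -> : \sum_(j <- s) (if j == k then ck else c j) * a j i =
    \sum_(j <- s) (c j * (a j i - p j * a k i) + c j * p j * a k i).
  apply: eq_big_seq => j js; case: eqP => [jk|_]; last by lra.
  by rewrite jk (negPf ks) in js.
rewrite big_split /= -bE -mulr_suml /ck; lra.
Qed.

(** The sign conditions on [z] join the constraints as coordinate forms; dropping their nonnegative
    multipliers turns the equality into an inequality. *)
Lemma farkas_nonneg (R : realFieldType) (I J : finType) (a : J -> I -> R)
    (b : I -> R) :
  (forall z : I -> R, (forall i, 0 <= z i) ->
     (forall j, 0 <= \sum_i a j i * z i) -> 0 <= \sum_i b i * z i) ->
  exists2 c : J -> R, forall j, 0 <= c j &
    forall i, \sum_j c j * a j i <= b i.
Proof.
move=> b_ge0.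
pose a' (k : I + J) i := match k with inl i' => (i' == i)%:R | inr j => a j i end.
case: (@farkas_seq R I (I + J)%type (index_enum _) a' b).
- exact: index_enum_uniq.
- move=> z az; apply: b_ge0 => [i|j]; last exact: (az (inr j) (mem_index_enum _)).
  have := az (inl i) (mem_index_enum _).
  rewrite (bigD1 i) //= eqxx mul1r big1 ?addr0 // => j.
  by rewrite eq_sym => /negPf ->; rewrite mul0r.
- move=> c c_ge0 bE; exists (c \o inr) => [j|i] /=; first exact: c_ge0.
  rewrite bE big_sumType /= lerDr sumr_ge0 // => j _.
  by rewrite mulr_ge0.
Qed.

(** Keeping [w] arbitrary serves both the first stage ([w = x]) and the later ones
    ([w = 1 - y_{i-1}]). *)
Lemma phi_bound_dual (R : realType) (F L : finType) (A : {set F * F})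
    (U : F -> F -> L -> R) (u : F -> L -> R) (f : F) (w : F -> R) (r : R) :
  0 <= r ->
  (forall P, admissible_weights U u f P -> r <= phi A f P w) <->
  exists lam v, [/\ r <= dot (u f) v + lam,
    forall s, (s, f) \in A -> dot (U f s) v + lam * w s <= 0,
    forall s, (s, f) \notin A -> dot (U f s) v <= 0,
    forall l, 0 <= v l & 0 <= lam <= 1].
Proof.
move=> r_ge0; split; last first.
  case=> lam [v [r_le vA vnA v_ge0 /andP[lam_ge0 lam_le1]]] P [P_ge0 UP].
  (* Weak duality: [r <= u.v + lam <= lam * (1 - sum P w) <= lam * phi <= phi], the last step by
     [lam <= 1] and [phi >= 0]. *)
  have u_le : dot (u f) v <= \sum_s P s * dot (U f s) v.
    apply: (@le_trans _ _ (\sum_l (\sum_s U f s l * P s) * v l)).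
      by apply: ler_sum => l _; rewrite ler_wpM2r.
    under eq_bigr do rewrite mulr_suml.
    rewrite exchange_big /=; apply: ler_sum => s _; rewrite mulr_sumr.
    by apply: ler_sum => l _; rewrite mulrAC mulrC mulrA.
  have w_le : \sum_s P s * dot (U f s) v <=
      - (lam * \sum_(s | (s, f) \in A) P s * w s).
    rewrite mulr_sumr -sumrN [leRHS]big_mkcond /=; apply: ler_sum => s _.
    case: ifPn => [/vA vs|/vnA vs].
      rewrite mulrCA -mulrN ler_wpM2l //; lra.
    by rewrite mulr_ge0_le0.
  apply: (@le_trans _ _ (lam * phi A f P w)); last first.
    by rewrite ler_piMl // /phi le_max lexx orbT.
  apply: (@le_trans _ _ (lam * (1 - \sum_(s | (s, f) \in A) P s * w s))).
    lra.
  by rewrite ler_wpM2l // /phi le_max lexx.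
move=> r_le.
(* Extending [w] by zero off the arcs lets one family of columns yield both the arc and the non-arc
   constraints. *)
pose w' s := if (s, f) \in A then w s else 0.
(* Coordinates of [z]: the homogenizing variable at [None], the value of the
   linear program at [Some None], the weights at [Some (Some s)]. *)
pose a (j : option L) (i : option (option F)) : R :=
  match j, i with
  | Some l, None => - u f l
  | Some l, Some None => 0
  | Some l, Some (Some s) => U f s l
  | None, None => - 1
  | None, Some None => 1
  | None, Some (Some s) => w' s
  end.
(* With [h] the homogenizing variable and [t] the program value, [b] is the form [t - r * h]. *)
pose b (i : option (option F)) : R :=
  match i with None => - r | Some None => 1 | Some (Some _) => 0 end.
have sum_opt (T : finType) (g : option T -> R) :
    \sum_i g i = g None + \sum_i g (Some i).
  rewrite (bigD1 None) //= (reindex_omap Some id) /= => [|[]] //.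
  by congr (_ + _); apply: eq_bigl => i; rewrite eqxx.
case: (@farkas_nonneg R _ _ a b).
  move=> z z_ge0 az; rewrite !sum_opt /= big1 ?addr0 => [|s _]; last first.
    by rewrite mul0r.
  set h := z None; set t := z (Some None).
  have t_ge0 : 0 <= t by exact: z_ge0.
  have : 0 <= h by exact: z_ge0.
  (* For [h = 0] the form is just [t >= 0]; for [h > 0] division by [h] yields an admissible point.
     An empty polytope thus leaves only the first case. *)
  rewrite le_eqVlt => /orP[/eqP <-|h_gt0]; first by lra.
  have admP : admissible_weights U u f (fun s => z (Some (Some s)) / h).
    split=> [s|l]; first by rewrite divr_ge0 // ltW.
    under eq_bigr do rewrite mulrA.
    rewrite -mulr_suml ler_pdivlMr //.
    by have := az (Some l); rewrite !sum_opt /= -/h; lra.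
  have : phi A f (fun s => z (Some (Some s)) / h) w <= t / h.
    rewrite /phi ge_max divr_ge0 // ?andbT; last exact: ltW.
    rewrite lerBlDr -lerBlDl.
    have -> : \sum_(s | (s, f) \in A) z (Some (Some s)) / h * w s =
        (\sum_s w' s * z (Some (Some s))) / h.
      rewrite big_mkcond mulr_suml; apply: eq_bigr => s _; rewrite /w'.
      by case: ifP => _; lra.
    rewrite lerBlDl -mulrDl ler_pdivlMr // mul1r.
    by have := az None; rewrite !sum_opt /= -/h -/t; lra.
  move=> /(le_trans (r_le _ admP)); rewrite ler_pdivlMr //; lra.
(* The multipliers are the dual variables: column [None] gives the bound on [r], column [Some None]
   gives [lam <= 1], the others the constraints on [v]. *)
move=> c c_ge0 cb; exists (c None), (c \o Some).
have cU s : dot (U f s) (c \o Some) + c None * w' s <= 0.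
  have := cb (Some (Some s)); rewrite sum_opt /= addrC /dot.
  by under eq_bigr do rewrite mulrC.
split=> [|s sA|s sA|l|] /=; try exact: c_ge0.
- have := cb None; rewrite sum_opt /= /dot.
  under eq_bigr do rewrite mulrN mulrC.
  rewrite sumrN; lra.
- by have := cU s; rewrite /w' sA.
- by have := cU s; rewrite /w' (negPf sA) mulr0 addr0.
- rewrite c_ge0 /=; have := cb (Some None); rewrite sum_opt /=.
  by rewrite big1 => [|l _]; rewrite ?mulr0 // addr0 mulr1.
Qed.

(** The [w] of the robust constraint at stage [i]. Since [i.-1 < Np] holds even for [i = 0], the
    predecessor ordinal needs no positivity proof. *)
Definition stage_weights {R : realType} {F : finType} {Np : nat} (x : F -> R)
    (y : F -> 'I_Np -> R) (i : 'I_Np) (s : F) : R :=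
  if i == 0%N :> nat then x s
  else 1 - y s (Ordinal (leq_ltn_trans (leq_pred i) (ltn_ord i))).

Lemma stage_weights0 (R : realType) (F : finType) (Np : nat) (x : F -> R)
    (y : F -> 'I_Np -> R) (i : 'I_Np) :
  i = 0%N :> nat -> stage_weights x y i = x.
Proof. by move=> /eqP i0; apply/funext => s; rewrite /stage_weights i0. Qed.

Lemma stage_weightsS (R : realType) (F : finType) (Np : nat) (x : F -> R)
    (y : F -> 'I_Np -> R) (j i : 'I_Np) :
  i = j.+1 :> nat -> stage_weights x y i = fun s => 1 - y s j.
Proof.
move=> ij; apply/funext => s; have i_neq0 : (i == 0%N :> nat) = false by rewrite ij.
rewrite /stage_weights i_neq0.
by congr (1 - y s _); apply: val_inj; rewrite /= ij.
Qed.

Lemma stage_case (Np : nat) (i : 'I_Np) :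
  i = 0%N :> nat \/ exists j : 'I_Np, i = j.+1 :> nat.
Proof.
case: (posnP i) => [|i_gt0]; first by left.
right; exists (Ordinal (leq_ltn_trans (leq_pred i) (ltn_ord i))) => /=.
by rewrite prednK.
Qed.

(** For fixed [y] the dual constraints decouple over the pairs [(f, i)], so duality applies to each
    pair separately and choice collects the multipliers. *)
Lemma follower_feasibleP (R : realType) (F L : finType) (Np : nat)
    (A : {set F * F}) (U : F -> F -> L -> R) (u : F -> L -> R) (x : F -> R)
    (y : F -> 'I_Np -> R) :
  follower_feasible A U u x y <->
  exists (lam : F -> 'I_Np -> R) (v : F -> 'I_Np -> L -> R),
    reformulation_feasible A U u x y lam v.
Proof.
split=> [[y1 ymono yr1 yr ybox]|[lam [v [y1 ymono yv v1 vA vnA v_ge0 ybox lbox]]]].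
  have /choice[g gP] (k : F * 'I_Np) : exists lv : R * (L -> R),
      [/\ y k.1 k.2 <= dot (u k.1) lv.2 + lv.1,
        forall s, (s, k.1) \in A ->
          dot (U k.1 s) lv.2 + lv.1 * stage_weights x y k.2 s <= 0,
        forall s, (s, k.1) \notin A -> dot (U k.1 s) lv.2 <= 0,
        forall l, 0 <= lv.2 l & 0 <= lv.1 <= 1].
    case: k => f i /=; have /andP[y_ge0 _] := ybox f i.
    have [lam [v lvP]] : exists lam v, [/\ y f i <= dot (u f) v + lam,
        forall s, (s, f) \in A ->
          dot (U f s) v + lam * stage_weights x y i s <= 0,
        forall s, (s, f) \notin A -> dot (U f s) v <= 0,
        forall l, 0 <= v l & 0 <= lam <= 1].
      apply/phi_bound_dual => // P admP; case: (stage_case _ i) => [i0|[j ij]].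
        by rewrite stage_weights0 //; exact: yr1.
      by rewrite (stage_weightsS _ _ _ _ _ _ _ ij); exact: yr.
    by exists (lam, v).
  exists (fun f i => (g (f, i)).1), (fun f i => (g (f, i)).2).
  split=> // [f i|f s i sA i0|f s j i sA ij|f s i sA|f i|f i];
    have [/= ge gA gnA g_ge0 gbox] := gP (f, i) => //.
  - by have := gA _ sA; rewrite stage_weights0.
  - by have := gA _ sA; rewrite (stage_weightsS _ _ _ _ _ _ _ ij).
  - exact: gnA.
split=> // [f i i0|f j i ij]; have /andP[y_ge0 _] := ybox f i;
  apply/phi_bound_dual => //; exists (lam f i), (v f i); split=> // s sA.
- exact: v1.
- exact: vnA.
- exact: vA.
- exact: vnA.
Qed.

Theorem proposition1 (R : realType) (F L : finType) (Nc : int) (Np : nat)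
    (A : {set F * F}) (W : F -> R) (U : F -> F -> L -> R) (u : F -> L -> R)
    (x : F -> R)
    (hNc : Nc <= #|F|%:Z) (hNp : (1 <= Np)%N)
    (hW : forall f, 0 <= W f)
    (hx : forall f, x f = 0 \/ x f = 1)
    (hxNc : \sum_f x f <= Nc%:~R) :
  (forall y : F -> 'I_Np -> R,
     follower_feasible A U u x y <->
     exists (lam : F -> 'I_Np -> R) (v : F -> 'I_Np -> L -> R),
       reformulation_feasible A U u x y lam v) /\
  (forall q : R,
     is_max_value [set y : F -> 'I_Np -> R | follower_feasible A U u x y]
       (fun y => objective W y) q <->
     is_max_value
       [set z : (F -> 'I_Np -> R) * (F -> 'I_Np -> R) * (F -> 'I_Np -> L -> R) |
          reformulation_feasible A U u x z.1.1 z.1.2 z.2]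
       (fun z => objective W z.1.1) q).
Proof.
split=> [y|q]; first exact: follower_feasibleP.
rewrite /is_max_value.
(* Projection onto [y] preserves the objective, so both problems have the same set of attained
   values, whether or not a maximum exists. *)
suff -> : (fun y => objective W y) @`
      [set y : F -> 'I_Np -> R | follower_feasible A U u x y] =
    (fun z => objective W z.1.1) @`
      [set z : (F -> 'I_Np -> R) * (F -> 'I_Np -> R) * (F -> 'I_Np -> L -> R) |
        reformulation_feasible A U u x z.1.1 z.1.2 z.2] by [].
apply/seteqP; split=> r /= [].
  move=> y /follower_feasibleP[lam [v yP]] <-.
  by exists (y, lam, v).
move=> [[y lam] v] /= yP <-; exists y => //.
by apply/follower_feasibleP; exists lam, v.
Qed.
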